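(* For every integer $n\ge 2$ there exist a real number $a$ with $\frac1{n+1}<a<\frac1n$, a density $p\in L^1([0,1],\mathfrak B,\lambda)$ with $p\ge0$ which is not ($\lambda$-almost everywhere equal to) a constant, and a set of weight functions $\{\alpha_1,\alpha_2\}$ on $[0,1]$, such that $\mu_S=\mu$, where $\mu(B)=\int_B p\,d\lambda$ and $\mu_S$ is the measure obtained from $\mu$ by the equipped $2$-transformation $\{S,\alpha\}$, $S=S(a)=S_1\cup S_2$.
   Context: $\lambda$ is Lebesgue measure on $[0,1]$ and $\mathfrak B$ is the $\sigma$-field of Borel subsets of $[0,1]$. For $a\in(0,\frac12]$ define $S_1,S_2:[0,1]\to[0,1]$ by $$S_1(x)=\begin{cases}\frac{x}{1-a},&x\in[0,1-a),\\ \frac{x-a}{1-a},&x\in[1-a,1],\end{cases}\qquad S_2(x)=\begin{cases}\frac{x}{1-a},&x\in[0,a),\\ \frac{x-a}{1-a},&x\in[a,1].\end{cases}$$ The $2$-valued transformation is $S=S(a)=S_1\cup S_2$. A set of weight functions (equipment) is a pair $\alpha=\{\alpha_1,\alpha_2\}$ with $\alpha_1,\alpha_2\in L^1([0,1],\mathfrak B,\lambda)$, $\alpha_1,\alpha_2\ge 0$ and $\alpha_1(x)+\alpha_2(x)\equiv 1$. Given $\mu=\int p\,d\lambda$, the measure $\mu_S$ is defined for $B\in\mathfrak B$ by $$\mu_S(B)=\int_{S_1^{-1}(B)}\alpha_1(x)p(x)\,d\lambda+\int_{S_2^{-1}(B)}\alpha_2(x)p(x)\,d\lambda.$$ *)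

(* Defs.v *)
From HB Require Import structures.
From mathcomp Require Import all_boot all_order all_algebra.
From mathcomp Require Import all_classical all_reals all_analysis.

Set Implicit Arguments.
Unset Strict Implicit.
Unset Printing Implicit Defensive.

Import Order.TTheory GRing.Theory Num.Theory.
Import numFieldNormedType.Exports.

Local Open Scope classical_set_scope.
Local Open Scope ring_scope.

(* Functions on [0,1] are represented by functions R -> R of which only the
   restriction to [unit_itv R] matters. *)
Definition unit_itv (R : realType) : set R := `[0, 1].
Arguments unit_itv R : clear implicits.

Definition S1 (R : realType) (a x : R) : R :=
  if x < 1 - a then x / (1 - a) else (x - a) / (1 - a).

Definition S2 (R : realType) (a x : R) : R :=
  if x < a then x / (1 - a) else (x - a) / (1 - a).

Definition L1 (R : realType) (f : R -> R) : Prop :=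
  (@lebesgue_measure R).-integrable (unit_itv R) (EFin \o f).

Definition weight_functions (R : realType) (alpha1 alpha2 : R -> R) : Prop :=
  [/\ L1 alpha1,
      L1 alpha2,
      forall x, unit_itv R x -> 0 <= alpha1 x,
      forall x, unit_itv R x -> 0 <= alpha2 x &
      forall x, unit_itv R x -> alpha1 x + alpha2 x = 1].

Definition density_measure (R : realType) (p : R -> R) (B : set R) : \bar R :=
  (\int[@lebesgue_measure R]_(x in B) (p x)%:E)%E.

(* The measure obtained from [density_measure p] by the 2-transformation
   [T1 \cup T2] equipped with the weights [alpha1], [alpha2]; preimages are
   taken in [0,1]. *)
Definition transformed_measure (R : realType) (T1 T2 alpha1 alpha2 p : R -> R)
    (B : set R) : \bar R :=
  (\int[@lebesgue_measure R]_(x in unit_itv R `&` T1 @^-1` B)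
      (alpha1 x * p x)%:E +
   \int[@lebesgue_measure R]_(x in unit_itv R `&` T2 @^-1` B)
      (alpha2 x * p x)%:E)%E.

Definition ae_constant (R : realType) (p : R -> R) : Prop :=
  exists c : R,
    {ae @lebesgue_measure R, forall x, unit_itv R x -> p x = c}.

(* Main.v *)
Require Import Defs.
From HB Require Import structures.
From mathcomp Require Import all_boot all_order all_algebra.
From mathcomp Require Import all_classical all_reals all_analysis.
From mathcomp Require Import measurable_realfun.
From mathcomp Require Import ring lra.

Set Implicit Arguments.
Unset Strict Implicit.
Unset Printing Implicit Defensive.

Import Order.TTheory GRing.Theory Num.Theory.
Import numFieldNormedType.Exports.

Local Open Scope classical_set_scope.
Local Open Scope ring_scope.

(* The weights [alpha1 = 0], [alpha2 = 1] reduce the 2-transformation to [S2],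
   which maps [[0, a / (1 - a))] into itself and is there, up to scaling, the
   beta-transformation of ratio [1 / (1 - a)].  Choosing [a] with
   [(1 - a) ^ (l + 1) = a] makes the orbit of the right end point finite, so
   Parry's invariant density is a finite step function; it vanishes to the
   right of [a / (1 - a) = (1 - a) ^ l < 1] and is therefore not constant. *)

(** * Choice of the parameter [a] *)

(* [l + 1] is the least [m] such that [(1 - 1 / n) ^ m < 1 / n]. *)
Lemma exists_power_gap (R : realType) (n : nat) : (2 <= n)%N ->
  exists l : nat, [/\ (0 < l)%N,
    n.+1%:R^-1 < (1 - n.+1%:R^-1) ^+ l.+1 :> R &
    (1 - n%:R^-1) ^+ l.+1 < n%:R^-1 :> R].
Proof.
move=> n2; set N : R := n%:R; set q : R := 1 - N^-1.
have N2 : 2 <= N by rewrite ler_nat.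
have N0 : 0 < N by lra.
have V0 : 0 < N^-1 by rewrite invr_gt0.
have V2 : N^-1 <= 2^-1 by rewrite lef_pV2// posrE; lra.
have q0 : 0 < q by rewrite /q; lra.
have exm : exists m, q ^+ m < N^-1.
  have q1 : `|q| < 1 by rewrite gtr0_norm// /q; lra.
  have /cvgrPdist_lt/(_ _ V0)[m _ /(_ m (leqnn m))] := cvg_expr q1.
  by rewrite sub0r normrN normrX gtr0_norm// => qm; exists m.
(* The least exponent is at least 2, because [1] and [q = 1 - N^-1] are both at least [N^-1] when
   [2 <= N]; this gives [0 < l]. *)
case: (ex_minnP exm) => -[|[|l]].
- by rewrite expr0; lra.
- by rewrite expr1 /q; lra.
move=> ql minl; exists l.+1; split => //.
have qV : N^-1 <= q ^+ l.+1.
  by rewrite leNgt; apply/negP => /minl; rewrite ltnn.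
rewrite -natr1 -/N; set Q := 1 - (N + 1)^-1.
have QE : Q = N * (N + 1)^-1 by rewrite /Q; field; lra.
have qQ : q < Q by rewrite /q /Q ltrD2l ltrN2 ltf_pV2 ?posrE; lra.
have Q0 : 0 < Q by exact: lt_trans qQ.
(* Writing [(N + 1)^-1] as [Q * N^-1] cancels one factor [Q]; what remains is
   [N^-1 <= q ^+ l.+1 < Q ^+ l.+1], where the first bound is the minimality of the exponent. *)
have -> : (N + 1)^-1 = Q * N^-1 by rewrite QE; field; rewrite !gt_eqF//; lra.
rewrite exprS ltr_pM2l//; apply: le_lt_trans qV _.
by rewrite ltrXn2r// ltW.
Qed.

(** Intermediate value theorem for the polynomial [X - (1 - X) ^ m]; the strict inequalities at [u]
    and [v] keep the root off the end points. *)
Lemma exists_root_between (R : realType) (u v : R) (m : nat) : u < v ->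
  u < (1 - u) ^+ m -> (1 - v) ^+ m < v ->
  exists a, [/\ u < a, a < v & (1 - a) ^+ m = a].
Proof.
move=> uv hu hv.
pose f : {poly R} := 'X - (1 - 'X) ^+ m.
have fE x : f.[x] = x - (1 - x) ^+ m by rewrite /f !hornerE.
have [|x /andP[ux xv] /rootP] := @poly_ivt _ f u v (ltW uv).
  by rewrite !fE subr_le0 subr_ge0 !ltW.
rewrite fE => /eqP; rewrite subr_eq0 => /eqP xE.
exists x; rewrite !lt_neqAle ux xv !andbT; split => //.
- by apply/eqP => ux'; move: hu; rewrite ux' -xE ltxx.
- by apply/eqP => ux'; move: hv; rewrite -ux' -xE ltxx.
Qed.

(** * Lebesgue measure under affine maps *)

Lemma measurable_affine (R : realType) (r b : R) :
  measurable_fun [set: measurableTypeR R]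
    ((fun x => (x - r) / b) : _ -> measurableTypeR R).
Proof. by apply: measurable_funM => //; exact: measurable_funB. Qed.

(** By uniqueness of Lebesgue measure: the pushforward under the affine map, scaled by [b^-1], gives
    every half-open interval its length. *)
Lemma lebesgue_measure_affine (R : realType) (r b : R) (A : set R) :
  0 < b -> measurable A ->
  lebesgue_measure ((fun x => (x - r) / b) @^-1` A) =
  (b%:E * lebesgue_measure A)%E.
Proof.
move=> b0 mA; have bN0 := lt0r_neq0 b0.
pose phi : measurableTypeR R -> measurableTypeR R := fun x => (x - r) / b.
have mphi : measurable_fun setT phi by exact: measurable_affine.
have bV0 : 0 <= b^-1 by rewrite invr_ge0 ltW.
pose mu : {measure set (measurableTypeR R) -> \bar R} :=
  mscale (NngNum bV0)
    (measure_function_pushforward__canonical__measure_function_Measure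
       lebesgue_measure mphi).
rewrite (_ : lebesgue_measure A = mu A); last first.
  apply: lebesgue_measure_unique => // _ [[u v]] _ <-.
  rewrite /= /mscale/= /pushforward.
  rewrite (_ : phi @^-1` _ = `]u * b + r, v * b + r]%classic); last first.
    by apply/seteqP; split => x /=;
      rewrite !in_itv/= /phi ltr_pdivlMr// ler_pdivrMr// ltrBrDr lerBlDr//.
  rewrite !lebesgue_measure_itv/= !lte_fin ltrD2r ltr_pM2r//.
  case: ifP => _; last by rewrite mule0.
  by rewrite -!EFinB -EFinM; congr EFin; field.
by rewrite /= /mscale/= /pushforward muleA -EFinM divff ?mul1e//.
Qed.

Lemma lebesgue_measure_affine_itv (R : realType) (r s b : R) (B : set R) :
  0 < b -> measurable B ->
  lebesgue_measure (`[r, s[ `&` (fun x => (x - r) / b) @^-1` B) =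
  (b%:E * lebesgue_measure (`[0%R, ((s - r) / b)%R[ `&` B))%E.
Proof.
move=> b0 mB; rewrite -(lebesgue_measure_affine r b0); last exact: measurableI.
congr (lebesgue_measure _); rewrite preimage_setI; congr (_ `&` _).
by apply/seteqP; split => x /=;
  rewrite !in_itv/= ltr_pM2r ?invr_gt0// pmulr_lge0 ?invr_gt0// subr_ge0 ltrD2r.
Qed.

(** * Preimages under [S2] *)

Lemma measurable_S2 (R : realType) (a : R) (B : set R) :
  measurable B -> measurable (S2 a @^-1` B).
Proof.
move=> mB; rewrite -[X in measurable X]setTI.
apply: (_ : measurable_fun [set: measurableTypeR R]
    (S2 a : _ -> measurableTypeR R)) => //.
apply: measurable_fun_ifT; first exact: measurable_fun_ltr.
- by apply: measurable_funM.
- by apply: measurable_affine.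
Qed.

Section S2_preimage.
Variables (R : realType) (a : R) (B : set R).
Hypotheses (a1 : a < 1) (mB : measurable B).

Let b0 : 0 < 1 - a. Proof. by rewrite subr_gt0. Qed.

Lemma lebesgue_measure_S2_low (c : R) : c <= a ->
  lebesgue_measure (`[0%R, c[ `&` (unit_itv R `&` S2 a @^-1` B)) =
  ((1 - a)%:E * lebesgue_measure (`[0%R, (c / (1 - a))%R[ `&` B))%E.
Proof.
move=> ca; have := lebesgue_measure_affine_itv 0 c b0 mB.
rewrite subr0 => <-; congr (lebesgue_measure _).
apply/seteqP; split => x /=; rewrite /unit_itv /S2/= !in_itv/= subr0.
- by move=> [/andP[x0 xc] [_]]; rewrite x0 xc (lt_le_trans xc ca).
- move=> [/andP[x0 xc]]; rewrite x0 xc (lt_le_trans xc ca) => Bx.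
  by do !split => //; exact: ltW (lt_trans (lt_le_trans xc ca) a1).
Qed.

(** Cut [[0, c[] at [a]: both branches of [S2] have slope [1 / (1 - a)] and start from the value 0,
    so each piece is carried onto an interval that again starts at 0. *)
Lemma lebesgue_measure_S2_high (c : R) : 0 <= a <= c -> c <= 1 ->
  lebesgue_measure (`[0%R, c[ `&` (unit_itv R `&` S2 a @^-1` B)) =
  ((1 - a)%:E * lebesgue_measure (`[0%R, (a / (1 - a))%R[ `&` B) +
   (1 - a)%:E * lebesgue_measure (`[0%R, ((c - a) / (1 - a))%R[ `&` B))%E.
Proof.
move=> /andP[a0 ac] c1; rewrite -(lebesgue_measure_S2_low (lexx a)).
rewrite -(lebesgue_measure_affine_itv a c b0 mB).
have mS : measurable (unit_itv R `&` S2 a @^-1` B).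
  by apply: measurableI; [exact: measurable_itv|exact: measurable_S2].
rewrite -measureU.
- congr (lebesgue_measure _).
  apply/seteqP; split => x /=; rewrite /unit_itv /S2/= !in_itv/=.
  + move=> [/andP[x0 xc] [/andP[_ x1] Bx]]; move: Bx; case: (ltP x a) => xa Bx.
      by left; rewrite x0 x1.
    by right; rewrite xc.
  + move=> [[/andP[x0 xa] [/andP[_ x1] Bx]]|[/andP[ax xc] Bx]].
      by rewrite x0 x1 (lt_le_trans xa ac).
    rewrite xc ltNge ax (le_trans a0 ax).
    by do !split => //; exact: ltW (lt_le_trans xc c1).
- exact: measurableI.
- apply: measurableI => //; rewrite -[X in measurable X]setTI.
  exact: measurable_affine.
- apply/seteqP; split => x //= [[+ _] [+ _]]; rewrite !in_itv/=.
  by move=> /andP[_ xa] /andP[]; rewrite leNgt xa.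
Qed.

End S2_preimage.

(** * Step functions *)

(** All intervals start at 0 because the transfer operator of [S2] sends indicators of such
    intervals, with right end in [[0, 1]], to combinations of the same kind. *)
Definition step_fun (R : realType) (N : nat) (w c : nat -> R) (x : R) : R :=
  \sum_(k < N) w k * \1_(`[0, c k[) x.

Section step_fun.
Variables (R : realType) (N : nat) (w c : nat -> R).
Hypothesis w0 : forall k, 0 <= w k.

Lemma step_fun_ge0 x : 0 <= step_fun N w c x.
Proof. by apply: sumr_ge0 => k _; rewrite mulr_ge0. Qed.

Lemma integral_step_fun (D : set R) : measurable D ->
  (\int[lebesgue_measure]_(x in D) (step_fun N w c x)%:E =
   \sum_(k < N) (w k)%:E * lebesgue_measure (`[0%R, c k[ `&` D))%E.
Proof.
move=> mD; under eq_integral do rewrite /step_fun -sumEFin.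
rewrite ge0_integral_sum//=.
- apply: eq_bigr => k _.
  under eq_integral do rewrite EFinM.
  rewrite ge0_integralZl_EFin//; first by rewrite integral_indic.
  by apply/measurable_EFinP.
- move=> k; apply/measurable_EFinP; apply: measurable_funM => //.
- by move=> k x _; rewrite lee_fin mulr_ge0.
Qed.

Lemma L1_step_fun : L1 (step_fun N w c).
Proof.
rewrite /L1.
rewrite (_ : EFin \o _ = fun x =>
    (\sum_(k < N) (w k)%:E * (\1_(`[0%R, c k[) x)%:E)%E); last first.
  by apply/funext => x /=; rewrite /step_fun -sumEFin.
apply: integrable_sum => [|k _]; first exact: measurable_itv.
apply: integrableZl; first exact: measurable_itv.
apply: (integrableS (E := setT)) => //; first exact: measurable_itv.
exact: integrable_indic_itv.
Qed.

End step_fun.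

(** * Non-constancy *)

Lemma not_negligible_itv (R : realType) (u v : R) (b1 b2 : bool) :
  u < v ->
  ~ (@lebesgue_measure R).-negligible [set` Interval (BSide b1 u) (BSide b2 v)].
Proof.
move=> uv /negligibleP => /(_ (measurable_itv _)).
rewrite /= lebesgue_measure_itv/= lte_fin uv -EFinB => -[] /eqP.
by rewrite subr_eq0 gt_eqF.
Qed.

(** The constant 0 fails on all of [[0, c[], any other constant on all of [[c, 1]], and neither
    interval is negligible. *)
Lemma not_ae_constant_vanishing_right (R : realType) (p : R -> R) (c : R) :
  0 < c < 1 -> (forall x, 0 <= x < c -> p x != 0) ->
  (forall x, c <= x -> p x = 0) -> ~ ae_constant p.
Proof.
move=> /andP[c0 c1] pl pr [d hd].
have [d0|dN0] := eqVneq d 0.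
- apply: (@not_negligible_itv R 0 c true true c0).
  apply: negligibleS hd => x /=; rewrite in_itv/= => /[dup] /andP[x0 xc] xI hx.
  move: (pl _ xI); rewrite hx ?d0 ?eqxx// /unit_itv/= in_itv/= x0.
  exact: ltW (lt_trans xc c1).
- apply: (@not_negligible_itv R c 1 true false c1).
  apply: negligibleS hd => x /=; rewrite in_itv/= => /andP[cx x1] hx.
  move/eqP: dN0; apply; rewrite -hx ?pr// /unit_itv/= in_itv/= x1 andbT.
  exact: ltW (lt_le_trans c0 cx).
Qed.

(** * Parry's density and its invariance *)

(* Under [S2 (1 - b)] with [b ^ (l + 1) = 1 - b], the orbit of [b ^ l] (as a
   left limit) is [b ^ l, b ^ (2 l), b ^ (2 l - 1), ..., b ^ (l + 1), 0]; the
   weight of [[0, b ^ (l + k))] is [b] to the time needed to reach its end. *)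
Definition parry_weight (R : realType) (b : R) (l k : nat) : R :=
  if k is 0%N then 1 else b ^+ (l.+1 - k).

Definition parry_density (R : realType) (b : R) (l : nat) : R -> R :=
  step_fun l.+1 (parry_weight b l) (fun k => b ^+ (l + k)).

Section parry.
Variables (R : realType) (b : R) (l : nat).
Hypotheses (b0 : 0 < b) (b1 : b < 1) (bl : b ^+ l.+1 = 1 - b).

Lemma parry_weight_ge0 k : 0 <= parry_weight b l k.
Proof. by case: k => [|k] //=; rewrite exprn_ge0// ltW. Qed.

Lemma parry_density_left x : 0 <= x < b ^+ l -> parry_density b l x != 0.
Proof.
move=> xI; rewrite gt_eqF// /parry_density /step_fun big_ord_recl/= addn0.
rewrite indicE mem_set ?in_itv//= mulr1 ltr_pwDl//.
by apply: sumr_ge0 => k _; rewrite mulr_ge0 ?exprn_ge0// ltW.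
Qed.

Lemma parry_density_right x : b ^+ l <= x -> parry_density b l x = 0.
Proof.
move=> bx; rewrite /parry_density /step_fun big1// => k _.
rewrite indicE memNset ?mulr0// /= in_itv/= => /andP[_].
rewrite ltNge (le_trans _ bx)// exprD ler_piMr ?exprn_ge0 ?exprn_ile1//; exact: ltW.
Qed.

(** For [k > 0] the interval [[0, b ^ (l + k)[] lies under the lower branch, which carries it onto
    the one of index [k - 1] with a factor [b]. For [k = 0] it splits into images of index [0] and
    [l], each with a factor [b]. At index [0] the contributions [b] and [b ^ (l + 1) = 1 - b] add up
    to the weight 1. *)
Lemma parry_density_invariant (B : set R) : measurable B ->
  density_measure (parry_density b l) (unit_itv R `&` S2 (1 - b) @^-1` B) =
  density_measure (parry_density b l) B.
Proof.
move=> mB; have bN0 := lt0r_neq0 b0; have b0' := ltW b0; have b1' := ltW b1.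
have a1 : 1 - b < 1 by rewrite ltrBlDr ltrDl.
have mS : measurable (unit_itv R `&` S2 (1 - b) @^-1` B).
  by apply: measurableI; [exact: measurable_itv|exact: measurable_S2].
rewrite /density_measure !integral_step_fun//; try exact: parry_weight_ge0.
(* Each interval is bounded, so its part in [B] has finite measure and the identity can be checked
   in [R], even when [B] has infinite measure. *)
pose M i := fine (lebesgue_measure (`[0, b ^+ (l + i)[ `&` B)).
have ME i : lebesgue_measure (`[0%R, (b ^+ (l + i))%R[ `&` B) = (M i)%:E.
  rewrite fineK// ge0_fin_numE//.
  apply: (@le_lt_trans _ _ (lebesgue_measure `[0%R, (b ^+ (l + i))%R[)).
    by apply: le_measure => //; rewrite inE//; exact: measurableI.
  by rewrite /= lebesgue_measure_itv/=; case: ifP => _; rewrite ltry.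
rewrite !big_ord_recl/= addn0 !mul1e.
rewrite lebesgue_measure_S2_high//; last 2 first.
- by rewrite -bl exprn_ge0//= exprS ler_piMl// exprn_ge0.
- exact: exprn_ile1.
have -> : (1 - b) / (1 - (1 - b)) = b ^+ (l + 0).
  by rewrite addn0 subKr -bl exprS mulrC mulKf.
have -> : (b ^+ l - (1 - b)) / (1 - (1 - b)) = b ^+ (l + l).
  rewrite subKr -bl exprS -[X in X - _]mul1r -mulrBl -bl exprS.
  by rewrite mulrC !mulrA mulVf// mul1r -exprD.
have M0E : lebesgue_measure (`[0%R, (b ^+ l)%R[ `&` B) = (M 0)%:E.
  by rewrite -ME addn0.
rewrite M0E !ME.
under eq_bigr => i _.
  rewrite lebesgue_measure_S2_low//; last first.
    by rewrite -bl ler_wiXn2l// /bump leq0n add1n addnS ltnS leq_addr.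
  rewrite (_ : _ / _ = b ^+ (l + i)); last first.
    by rewrite subKr /bump/= add1n addnS exprSr mulfK.
  rewrite ME subKr -!EFinM.
  over.
under [X in _ = (_ + X)%E]eq_bigr => i _ do rewrite ME -EFinM.
rewrite subKr !sumEFin -!EFinM -!EFinD; congr EFin.
(* The transformed side sums [F i] over [i < l], the other side over [1 <= i <= l]; the end terms
   [F l = b * M l] and [F 0 = (1 - b) * M 0] account for the difference. *)
pose F i := b ^+ (l.+1 - i) * M i.
rewrite (eq_bigr (fun i : 'I_l => F i)); last first.
  move=> i _; rewrite /F /bump/= add1n subSS mulrA; congr (_ * _).
  by rewrite -exprSr subSn// ltnW.
rewrite [in RHS](eq_bigr (fun i : 'I_l => F i.+1))//.
have telescope : \sum_(i < l) F i + F l = F 0 + \sum_(i < l) F i.+1.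
  by transitivity (\sum_(i < l.+1) F i); [rewrite big_ord_recr|rewrite big_ord_recl].
have Fl : F l = b * M l by rewrite /F subSnn expr1.
have F0 : F 0 = (1 - b) * M 0 by rewrite /F subn0 bl.
lra.
Qed.

End parry.

(** * Assembly with constant weights *)

Lemma L1_cst (R : realType) (k : R) : L1 (fun=> k).
Proof.
apply: continuous_compact_integrable; first exact: segment_compact.
by apply: continuous_subspaceT => x; exact: cvg_cst.
Qed.

Lemma transformed_measure_S2 (R : realType) (T1 T2 p : R -> R) (B : set R) :
  transformed_measure T1 T2 (fun=> 0) (fun=> 1) p B =
  density_measure p (unit_itv R `&` T2 @^-1` B).
Proof.
rewrite /transformed_measure.
under eq_integral do rewrite mul0r.
rewrite integral0 add0e.
by under eq_integral do rewrite mul1r.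
Qed.

Theorem theorem3 (R : realType) (n : nat) (hn : (2 <= n)%N) :
  exists a : R, n.+1%:R^-1 < a /\ a < n%:R^-1 /\
  exists p : R -> R,
    L1 p /\
    (forall x, unit_itv R x -> 0 <= p x) /\
    ~ ae_constant p /\
    exists alpha1 alpha2 : R -> R,
      weight_functions alpha1 alpha2 /\
      forall B : set R, measurable B -> B `<=` unit_itv R ->
        transformed_measure (S1 a) (S2 a) alpha1 alpha2 p B =
        density_measure p B.
Proof.
have [l [l0 hu hv]] := exists_power_gap R hn.
have uv : n.+1%:R^-1 < n%:R^-1 :> R.
  by rewrite ltf_pV2 ?posrE ?ltr_nat// ltr0n// ltnW.
have [a [ua av aE]] := exists_root_between uv hu hv.
have a0 : 0 < a by apply: lt_trans ua; rewrite invr_gt0 ltr0n.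
have a1 : a < 1.
  apply: lt_le_trans av _; rewrite invf_le1 ?ler1n ?ltr0n; exact: ltnW.
have b0 : 0 < 1 - a by rewrite subr_gt0.
have b1 : 1 - a < 1 by rewrite ltrBlDr ltrDl.
have bl : (1 - a) ^+ l.+1 = 1 - (1 - a) by rewrite subKr.
exists a; split => //; split => //; exists (parry_density (1 - a) l).
split; first exact: L1_step_fun.
split; first by move=> x _; apply: step_fun_ge0 => k; exact: parry_weight_ge0.
split.
  apply: (@not_ae_constant_vanishing_right _ _ ((1 - a) ^+ l)).
  (* Here [0 < l] is essential: it makes [(1 - a) ^+ l < 1], so the density vanishes on an interval
     of positive length. *)
  - by rewrite exprn_gt0//= exprn_ilt1 ?ltW// -lt0n.
  - by move=> x; exact: parry_density_left.
  - by move=> x; exact: parry_density_right.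
exists (fun=> 0), (fun=> 1); split.
  by split; [exact: L1_cst|exact: L1_cst|move=> *; rewrite ?ler01 ?add0r..].
move=> B mB _; rewrite transformed_measure_S2.
by have := parry_density_invariant b0 b1 bl mB; rewrite subKr.
Qed.
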